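(* For all real $x,y,z>0$, $$J_{(3,0,0)}(x,y,z)+J_{(1,1,1)}(x,y,z)\ge 2\max\left\{J_{(2,1,0)}(x,y,z),\ J_{(9/4,\,1/2,\,1/4)}(x,y,z)\right\}.$$ Consequently this inequality strictly refines the usual cubic Schur inequality $J_{(3,0,0)}+J_{(1,1,1)}\ge 2J_{(2,1,0)}$; that is, its right-hand side is everywhere at least $2J_{(2,1,0)}(x,y,z)$ and there exist $x,y,z>0$ at which it is strictly larger than $2J_{(2,1,0)}(x,y,z)$.
   Context: For a triple $\eta=(\eta_1,\eta_2,\eta_3)$ of nonnegative rationals and positive reals $x_1,x_2,x_3$, the labeled orbit sum is $J_\eta(x_1,x_2,x_3)=\sum_{\sigma\in S_3}\prod_{i=1}^3 x_i^{\eta_{\sigma(i)}}$, where all six permutations are counted, also when exponents repeat. *)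

(* Defs.v *)
From HB Require Import structures.
From mathcomp Require Import all_boot all_order all_fingroup all_algebra.
From mathcomp Require Import reals exp.

Set Implicit Arguments.
Unset Strict Implicit.
Unset Printing Implicit Defensive.

Import Order.TTheory GRing.Theory Num.Theory.
Local Open Scope ring_scope.

(* The labeled orbit sum J_(a, b, c)(x, y, z), meant for a, b, c >= 0 and
   x, y, z > 0, where [powR] is the usual real power.  The sum is over all six
   permutations, so repeated exponents give repeated terms. *)
Definition J (R : realType) (a b c : rat) (x y z : R) : R :=
  \sum_(s : 'S_3) \prod_(i < 3)
    tnth [tuple x; y; z] i `^ ratr (tnth [tuple a; b; c] (s i)).

(* Main.v *)
Require Import Defs.
From HB Require Import structures.
From mathcomp Require Import all_boot all_order all_fingroup all_algebra.
From mathcomp Require Import reals exp.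
From mathcomp Require Import ring lra.

(** Writing x = p^4, y = q^4, z = r^4 turns all three orbit sums into polynomials
    of degree 12.  By AM-GM, 2 p^9 q^2 r <= p^8 q^2 r^2 + p^10 q^2, so with
    a = p^2, b = q^2, c = r^2 the bound on J_(9/4, 1/2, 1/4) follows from a
    symmetric inequality of degree 6, which for a = c + u + v, b = c + u has only
    nonnegative coefficients in c, u, v.  The bound on J_(2, 1, 0) is Schur's
    inequality, and strictness holds at (16, 1, 1). *)

Set Implicit Arguments.
Unset Strict Implicit.
Unset Printing Implicit Defensive.

Import Order.TTheory GRing.Theory Num.Theory.
Local Open Scope ring_scope.

(** Laplace expansion of a permanent along its first row: permutations are grouped by the image [j]
    of [ord0], and [lift_perm ord0 j] identifies each group with ['S_n]. *)
Lemma permanent_expand_row0 (S : comNzRingType) n (F : 'I_n.+1 -> 'I_n.+1 -> S) :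
  \sum_(s : 'S_n.+1) \prod_i F i (s i) =
  \sum_j F ord0 j * \sum_(s : 'S_n) \prod_i F (lift ord0 i) (lift j (s i)).
Proof.
rewrite (partition_big (fun s : 'S_n.+1 => s ord0) xpredT) //=.
apply: eq_bigr => j _; rewrite (reindex (lift_perm ord0 j)) /=.
  rewrite big_distrr; apply: eq_big => [s|s _]; first by rewrite lift_perm_id eqxx.
  rewrite big_ord_recl lift_perm_id; congr (_ * _).
  by apply: eq_bigr => i _; rewrite lift_perm_lift.
(* Inverse of [lift_perm]: delete [ord0] from the source of [s] and [s ord0] from the target. The
   default [k] is never reached, since [s] is injective. *)
pose f (s : 'S_n.+1) k := odflt k (unlift (s ord0) (s (lift ord0 k))).
have fK (s : 'S_n.+1) k : lift (s ord0) (f s k) = s (lift ord0 k).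
  rewrite /f; have := neq_lift ord0 k.
  by rewrite -(can_eq (permK s)) => /unlift_some[? ? ->].
have f_inj s : injective (f s).
  move=> k l /(congr1 (lift (s ord0))); rewrite !fK.
  by move/perm_inj/lift_inj.
exists (fun s => perm (@f_inj s)) => [s _|s].
  by apply/permP => k; rewrite permE /f lift_perm_lift lift_perm_id liftK.
rewrite inE => /eqP s0; apply/permP => k.
case: (unliftP ord0 k) => [i|] ->; rewrite ?lift_perm_id //.
by rewrite lift_perm_lift -s0 permE fK.
Qed.

Lemma permanent1E (S : comNzRingType) (F : 'I_1 -> 'I_1 -> S) :
  \sum_(s : 'S_1) \prod_i F i (s i) = F 0 0.
Proof.
have s1 (s : 'S_1) : s = 1%g by apply/permP => i; rewrite !ord1.
rewrite (big_pred1 1%g) => [|s]; last by rewrite (s1 s) /= eqxx.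
by rewrite big_ord1 perm1.
Qed.

Lemma permanent2E (S : comNzRingType) (F : 'I_2 -> 'I_2 -> S) :
  \sum_(s : 'S_2) \prod_i F i (s i) = F 0 0 * F 1 1 + F 0 1 * F 1 0.
Proof.
rewrite permanent_expand_row0 !big_ord_recl big_ord0 addr0.
rewrite !(permanent1E (fun i k => F (@lift 2 _ i) (@lift 2 _ k))).
by congr (F _ _ * F _ _ + F _ _ * F _ _); apply: val_inj.
Qed.

(** Natural-number indices let the nested [lift]s of the two expansions be evaluated by
    computation. *)
Lemma permanent3E (S : comNzRingType) (F : 'I_3 -> 'I_3 -> S) :
  let f i j := F (inord i) (inord j) in
  \sum_(s : 'S_3) \prod_i F i (s i) =
    f 0 0 * f 1 1 * f 2 2 + f 0 0 * f 1 2 * f 2 1 +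
    f 0 1 * f 1 0 * f 2 2 + f 0 1 * f 1 2 * f 2 0 +
    f 0 2 * f 1 0 * f 2 1 + f 0 2 * f 1 1 * f 2 0.
Proof.
move=> f; have FE i j : F i j = f i j by rewrite /f !inord_val.
rewrite permanent_expand_row0 !big_ord_recl big_ord0.
rewrite !(permanent2E (fun i k => F (@lift 3 _ i) (@lift 3 _ k))) !FE /= /bump /=.
by rewrite addr0 !mulrDr !mulrA !addrA.
Qed.

Lemma powR_pow4 (R : realType) (p : R) (k : nat) :
  0 <= p -> (p ^+ 4) `^ ratr (k%:R / 4) = p ^+ k.
Proof.
move=> p0.
have -> : ratr (k%:R / 4) = 4^-1 * k%:R :> R.
  by rewrite fmorph_div /= !ratr_nat mulrC.
rewrite -(powR_mulrn 4) // -powRrM mulrA divff ?pnatr_eq0 // mul1r.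
exact: powR_mulrn.
Qed.

(** All exponents in the theorem are multiples of 1/4, so this one formula serves all four orbit
    sums. *)
Lemma J_pow4 (R : realType) (k l m : nat) (p q r : R) :
  0 <= p -> 0 <= q -> 0 <= r ->
  J (k%:R / 4) (l%:R / 4) (m%:R / 4) (p ^+ 4) (q ^+ 4) (r ^+ 4) =
    p ^+ k * q ^+ l * r ^+ m + p ^+ k * q ^+ m * r ^+ l +
    p ^+ l * q ^+ k * r ^+ m + p ^+ l * q ^+ m * r ^+ k +
    p ^+ m * q ^+ k * r ^+ l + p ^+ m * q ^+ l * r ^+ k.
Proof.
move=> p0 q0 r0; rewrite /J.
rewrite (permanent3E (fun i j => tnth [tuple p ^+ 4; q ^+ 4; r ^+ 4] i `^
  ratr (tnth [tuple k%:R / 4; l%:R / 4; m%:R / 4] j))) /=.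
by rewrite !(tnth_nth 0) !inordK //= !powR_pow4.
Qed.

Ltac nonneg := repeat first
  [ assumption | exact: ler0n | apply: addr_ge0 | apply: exprn_ge0
  | apply: mulr_ge0 ].

(** The two adjacent transpositions generate ['S_3], so a symmetric [P] need only be checked on
    sorted triples; these are parametrized by the least entry [c] and the gaps [u], [v]. *)
Lemma sorted3_wlog (R : realDomainType) (P : R -> R -> R -> Prop) :
  (forall a b c, P b a c -> P a b c) -> (forall a b c, P a c b -> P a b c) ->
  (forall c u v, 0 <= c -> 0 <= u -> 0 <= v -> P (c + u + v) (c + u) c) ->
  forall a b c, 0 <= a -> 0 <= b -> 0 <= c -> P a b c.
Proof.
move=> P12 P23 Psorted.
have sorted a b c : 0 <= c -> c <= b -> b <= a -> P a b c.
  move=> c0 cb ba; have := Psorted c (b - c) (a - b).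
  rewrite !subr_ge0 (_ : c + (b - c) = b); last by ring.
  by rewrite (_ : b + (a - b) = a); [apply | ring].
move=> a b c a0 b0 c0.
case: (leP b a) => [ba|/ltW ab]; case: (leP c b) => [cb|/ltW bc].
- exact: sorted.
- case: (leP c a) => [ca|/ltW ac]; first by apply: P23; apply: sorted.
  by apply: P23; apply: P12; apply: sorted.
- case: (leP c a) => [ca|/ltW ac]; first by apply: P12; apply: sorted.
  by apply: P12; apply: P23; apply: sorted.
- by apply: (P12); apply: P23; apply: P12; apply: sorted.
Qed.

Lemma schur_deg3 (R : realFieldType) (a b c : R) : 0 <= a -> 0 <= b -> 0 <= c ->
  a ^+ 2 * b + a ^+ 2 * c + b ^+ 2 * a + b ^+ 2 * c + c ^+ 2 * a + c ^+ 2 * b <=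
  a ^+ 3 + b ^+ 3 + c ^+ 3 + 3 * a * b * c.
Proof.
move: a b c; apply: sorted3_wlog => [a b c|a b c|c u v c0 u0 v0]; [lra..|].
rewrite -subr_ge0; set d := (X in 0 <= X).
suff -> : d = c * (u ^+ 2 + u * v + v ^+ 2) + v ^+ 2 * (v + 2 * u) by nonneg.
by rewrite /d; ring.
Qed.

(** At squares of [p], [q], [r] the left side is the sum of the six AM-GM bounds, and the right side
    is [J 3 0 0 + J 1 1 1] at their fourth powers. *)
Lemma sextic_le (R : realFieldType) (a b c : R) : 0 <= a -> 0 <= b -> 0 <= c ->
  a ^+ 5 * b + a ^+ 5 * c + b ^+ 5 * a + b ^+ 5 * c + c ^+ 5 * a + c ^+ 5 * b +
  2 * a * b * c * (a ^+ 3 + b ^+ 3 + c ^+ 3) <=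
  2 * (a ^+ 6 + b ^+ 6 + c ^+ 6) + 6 * (a * b * c) ^+ 2.
Proof.
move: a b c; apply: sorted3_wlog => [a b c|a b c|c u v c0 u0 v0]; [lra..|].
rewrite -subr_ge0; set d := (X in 0 <= X).
(* Expansion in powers of [c]. The terms in [c ^+ 6] and [c ^+ 5] cancel, because [d] vanishes to
   second order on the diagonal [u = v = 0]. *)
suff -> : d =
    4 * c ^+ 4 * (u ^+ 2 + u * v + v ^+ 2) +
    c ^+ 3 * (4 * u ^+ 3 + 6 * u ^+ 2 * v + 26 * u * v ^+ 2 + 12 * v ^+ 3) +
    c ^+ 2 * (6 * u ^+ 4 + 12 * u ^+ 3 * v + 60 * u ^+ 2 * v ^+ 2 +
              54 * u * v ^+ 3 + 18 * v ^+ 4) +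
    c * (6 * u ^+ 5 + 15 * u ^+ 4 * v + 58 * u ^+ 3 * v ^+ 2 +
         72 * u ^+ 2 * v ^+ 3 + 43 * u * v ^+ 4 + 10 * v ^+ 5) +
    (2 * u ^+ 6 + 6 * u ^+ 5 * v + 20 * u ^+ 4 * v ^+ 2 + 30 * u ^+ 3 * v ^+ 3 +
     25 * u ^+ 2 * v ^+ 4 + 11 * u * v ^+ 5 + 2 * v ^+ 6) by nonneg.
by rewrite /d; ring.
Qed.

(** The odd monomial is the geometric mean of two monomials with even exponents only, which makes
    the bound a polynomial in the squares. *)
Lemma amgm_term (R : realDomainType) (p q r : R) :
  2 * (p ^+ 9 * q ^+ 2 * r) <= p ^+ 8 * q ^+ 2 * r ^+ 2 + p ^+ 10 * q ^+ 2.
Proof.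
rewrite -subr_ge0; set d := (X in 0 <= X).
have -> : d = (p ^+ 4 * q * (p - r)) ^+ 2 by rewrite /d; ring.
exact: sqr_ge0.
Qed.

Lemma pow4_root (R : realType) (x : R) : 0 < x -> exists2 p, 0 < p & x = p ^+ 4.
Proof.
move=> x0; exists (x `^ 4^-1); first exact: powR_gt0.
rewrite -powR_mulrn ?powR_ge0 // -powRrM mulVf ?pnatr_eq0 // powRr1 //.
exact: ltW.
Qed.

(** The factor 2 counts the permutations that exchange the two zero exponents. *)
Lemma J300_pow4 (R : realType) (p q r : R) : 0 <= p -> 0 <= q -> 0 <= r ->
  J 3 0 0 (p ^+ 4) (q ^+ 4) (r ^+ 4) =
    2 * (p ^+ 12 + q ^+ 12 + r ^+ 12).
Proof.
move=> p0 q0 r0.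
have -> : 3 = 12%:R / 4 :> rat by [].
have -> : 0 = 0%:R / 4 :> rat by [].
by rewrite J_pow4 //; ring.
Qed.

Lemma J111_pow4 (R : realType) (p q r : R) : 0 <= p -> 0 <= q -> 0 <= r ->
  J 1 1 1 (p ^+ 4) (q ^+ 4) (r ^+ 4) =
    6 * (p * q * r) ^+ 4.
Proof.
move=> p0 q0 r0.
have -> : 1 = 4%:R / 4 :> rat by [].
by rewrite J_pow4 //; ring.
Qed.

Lemma J210_pow4 (R : realType) (p q r : R) : 0 <= p -> 0 <= q -> 0 <= r ->
  J 2 1 0 (p ^+ 4) (q ^+ 4) (r ^+ 4) =
    p ^+ 8 * q ^+ 4 + p ^+ 8 * r ^+ 4 + q ^+ 8 * p ^+ 4 + q ^+ 8 * r ^+ 4 +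
    r ^+ 8 * p ^+ 4 + r ^+ 8 * q ^+ 4.
Proof.
move=> p0 q0 r0.
have -> : 2 = 8%:R / 4 :> rat by [].
have -> : 1 = 4%:R / 4 :> rat by [].
have -> : 0 = 0%:R / 4 :> rat by [].
by rewrite J_pow4 //; ring.
Qed.

Lemma J_quarters_pow4 (R : realType) (p q r : R) : 0 <= p -> 0 <= q -> 0 <= r ->
  J (9 / 4) (1 / 2) (1 / 4) (p ^+ 4) (q ^+ 4) (r ^+ 4) =
    p ^+ 9 * q ^+ 2 * r + p ^+ 9 * r ^+ 2 * q + q ^+ 9 * p ^+ 2 * r +
    q ^+ 9 * r ^+ 2 * p + r ^+ 9 * p ^+ 2 * q + r ^+ 9 * q ^+ 2 * p.
Proof.
move=> p0 q0 r0.
have -> : 1 / 2 = 2%:R / 4 :> rat by [].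
have -> : 1 / 4 = 1%:R / 4 :> rat by [].
by rewrite J_pow4 //; ring.
Qed.

Theorem corollary13p3 (R : realType) :
  [/\ forall x y z : R, 0 < x -> 0 < y -> 0 < z ->
        J 3 0 0 x y z + J 1 1 1 x y z
        >= 2 * Num.max (J 2 1 0 x y z) (J (9 / 4) (1 / 2) (1 / 4) x y z),
      forall x y z : R, 0 < x -> 0 < y -> 0 < z ->
        2 * Num.max (J 2 1 0 x y z) (J (9 / 4) (1 / 2) (1 / 4) x y z)
        >= 2 * J 2 1 0 x y z
    & exists x y z : R, [/\ 0 < x, 0 < y, 0 < z &
        2 * Num.max (J 2 1 0 x y z) (J (9 / 4) (1 / 2) (1 / 4) x y z)
        > 2 * J 2 1 0 x y z]].
Proof.
split.
- move=> _ _ _ /pow4_root[p /ltW p0 ->] /pow4_root[q /ltW q0 ->]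
    /pow4_root[r /ltW r0 ->].
  rewrite J300_pow4 // J111_pow4 //.
  (* Each case leaves one argument of the maximum. Both bounds hold unconditionally, so the
     comparison itself is discarded. *)
  case: (leP (J 2 1 0 _ _ _)) => _.
    rewrite J_quarters_pow4 //.
    have := @sextic_le _ (p ^+ 2) (q ^+ 2) (r ^+ 2)
      (exprn_ge0 _ p0) (exprn_ge0 _ q0) (exprn_ge0 _ r0).
    (* One instance per ordering of [p], [q], [r]; together they bound
       [2 * J (9 / 4) (1 / 2) (1 / 4)]. *)
    have := amgm_term p q r; have := amgm_term p r q.
    have := amgm_term q p r; have := amgm_term q r p.
    have := amgm_term r p q; have := amgm_term r q p.
    lra.
  rewrite J210_pow4 //.
  have := @schur_deg3 _ (p ^+ 4) (q ^+ 4) (r ^+ 4)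
      (exprn_ge0 _ p0) (exprn_ge0 _ q0) (exprn_ge0 _ r0).
  lra.
- by move=> x y z *; rewrite ler_wpM2l // le_max lexx.
(* For large [x] and [y = z = 1] the exponent 9/4 beats 2. With fourth roots 2, 1, 1 the two sums
   are 1036 and 546. *)
exists (2 ^+ 4), (1 ^+ 4), (1 ^+ 4); split; rewrite ?exprn_gt0 //.
rewrite ltr_pM2l // lt_max ltxx /= J210_pow4 // J_quarters_pow4 //.
rewrite !expr1n; lra.
Qed.
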